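(* The size of the smallest connected vertex cover of the graph $G$ is $19$.
   Context: The graph $G$ has 32 vertices, $V=A\cup C\cup P\cup Q\cup R\cup Z\cup U$ (disjoint union), where $A=\{a_1,a_2,a_3\}$, $C=\{c_1,c_2,c_3\}$, $Q=\{q_1,q_2,q_3\}$, $R=\{r_1,r_2,r_3\}$, $Z=\{z_0,z_{12},z_{23},z_{13}\}$, $U=\{u_0,u_{12},u_{23},u_{13}\}$, and $P$ consists of 12 private vertices, two for each of the six support vertices (the vertices of $A\cup C$). Its edges are exactly: each support vertex is adjacent to its own two private vertices, and these two are adjacent to each other; for each $i\in\{1,2,3\}$ both $a_i$ and $c_i$ are adjacent to both $q_i$ and $r_i$; for $1\le i<j\le 3$, $z_{ij}$ is adjacent to $a_i,a_j,q_i,q_j$ and $u_{ij}$ is adjacent to $c_i,c_j,r_i,r_j$; $z_0$ is adjacent to $q_1,q_2,a_1$; $u_0$ is adjacent to $r_1,r_2,c_1$. A connected vertex cover of a graph is a set of vertices that meets every edge and induces a connected subgraph. *)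

(* Defs.v *)
From HB Require Import structures.
From mathcomp Require Import all_boot.

Set Implicit Arguments.
Unset Strict Implicit.
Unset Printing Implicit Defensive.

(* A simple graph on a finite type T is given by a symmetric irreflexive
   relation e : rel T. *)

Definition vertex_cover (T : finType) (e : rel T) (S : {set T}) : Prop :=
  forall x y : T, e x y -> (x \in S) || (y \in S).

Definition induced (T : finType) (e : rel T) (S : {set T}) : rel T :=
  [rel x y | [&& x \in S, y \in S & e x y]].

(* The empty set counts as connected; this is harmless for vertex covers of a
   graph having at least one edge. *)
Definition induces_connected (T : finType) (e : rel T) (S : {set T}) : Prop :=
  forall x y : T, x \in S -> y \in S -> connect (induced e S) x y.

Definition connected_vertex_cover (T : finType) (e : rel T) (S : {set T}) :
    Prop :=
  vertex_cover e S /\ induces_connected e S.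

Inductive idx := i1 | i2 | i3.
Inductive lab := l0 | l12 | l23 | l13.

(* [PA i b] and [PC i b], for b : bool, are the two private vertices of the
   support vertices [A i] and [C i]. *)
Inductive vertex :=
  | A of idx
  | C of idx
  | PA of idx & bool
  | PC of idx & bool
  | Q of idx
  | R of idx
  | Z of lab
  | U of lab.

Definition idx_code (i : idx) : nat :=
  match i with i1 => 0 | i2 => 1 | i3 => 2 end.
Definition idx_decode (k : nat) : idx :=
  match k with 0 => i1 | 1 => i2 | _ => i3 end.
Lemma idx_codeK : cancel idx_code idx_decode. Proof. by case. Qed.
HB.instance Definition _ := Countable.copy idx (can_type idx_codeK).
Definition idx_enum : seq idx := [:: i1; i2; i3].
Lemma idx_enumP : Finite.axiom idx_enum. Proof. by case. Qed.
HB.instance Definition _ := isFinite.Build idx idx_enumP.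

Definition lab_code (l : lab) : nat :=
  match l with l0 => 0 | l12 => 1 | l23 => 2 | l13 => 3 end.
Definition lab_decode (k : nat) : lab :=
  match k with 0 => l0 | 1 => l12 | 2 => l23 | _ => l13 end.
Lemma lab_codeK : cancel lab_code lab_decode. Proof. by case. Qed.
HB.instance Definition _ := Countable.copy lab (can_type lab_codeK).
Definition lab_enum : seq lab := [:: l0; l12; l23; l13].
Lemma lab_enumP : Finite.axiom lab_enum. Proof. by case. Qed.
HB.instance Definition _ := isFinite.Build lab lab_enumP.

Definition vertex_code (v : vertex) :
    idx + idx + idx * bool + idx * bool + idx + idx + lab + lab :=
  match v with
  | A i => inl (inl (inl (inl (inl (inl (inl i))))))
  | C i => inl (inl (inl (inl (inl (inl (inr i))))))
  | PA i b => inl (inl (inl (inl (inl (inr (i, b))))))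
  | PC i b => inl (inl (inl (inl (inr (i, b)))))
  | Q i => inl (inl (inl (inr i)))
  | R i => inl (inl (inr i))
  | Z l => inl (inr l)
  | U l => inr l
  end.
Definition vertex_decode
    (c : idx + idx + idx * bool + idx * bool + idx + idx + lab + lab) :
    vertex :=
  match c with
  | inl (inl (inl (inl (inl (inl (inl i)))))) => A i
  | inl (inl (inl (inl (inl (inl (inr i)))))) => C i
  | inl (inl (inl (inl (inl (inr (i, b)))))) => PA i b
  | inl (inl (inl (inl (inr (i, b))))) => PC i b
  | inl (inl (inl (inr i))) => Q i
  | inl (inl (inr i)) => R i
  | inl (inr l) => Z l
  | inr l => U l
  end.
Lemma vertex_codeK : cancel vertex_code vertex_decode.
Proof. by case. Qed.
HB.instance Definition _ := Countable.copy vertex (can_type vertex_codeK).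
Definition vertex_enum : seq vertex :=
  map A idx_enum ++ map C idx_enum ++
  [seq PA i b | i <- idx_enum, b <- [:: true; false]] ++
  [seq PC i b | i <- idx_enum, b <- [:: true; false]] ++
  map Q idx_enum ++ map R idx_enum ++ map Z lab_enum ++ map U lab_enum.
Lemma vertex_enumP : Finite.axiom vertex_enum.
Proof. by do 2?case=> //; case. Qed.
HB.instance Definition _ := isFinite.Build vertex vertex_enumP.

Lemma card_vertex : #|{: vertex}| = 32.
Proof. by rewrite cardT enumT unlock. Qed.

(* [in_pair l i] says that i is one of the two indices of a label l12, l23 or
   l13; it is false for l0. *)
Definition in_pair (l : lab) (i : idx) : bool :=
  match l with
  | l0 => false
  | l12 => i \in [:: i1; i2]
  | l23 => i \in [:: i2; i3]
  | l13 => i \in [:: i1; i3]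
  end.

(* Every edge of G in one orientation (the two private neighbours of a support
   vertex being listed in both). *)
Definition arc (x y : vertex) : bool :=
  match x, y with
  | A i, PA j _ => i == j
  | C i, PC j _ => i == j
  | PA i b, PA j b' => (i == j) && (b != b')
  | PC i b, PC j b' => (i == j) && (b != b')
  | A i, Q j => i == j
  | A i, R j => i == j
  | C i, Q j => i == j
  | C i, R j => i == j
  | Z l0, Q j => j \in [:: i1; i2]
  | Z l0, A j => j == i1
  | Z l, A j => in_pair l j
  | Z l, Q j => in_pair l j
  | U l0, R j => j \in [:: i1; i2]
  | U l0, C j => j == i1
  | U l, C j => in_pair l j
  | U l, R j => in_pair l j
  | _, _ => false
  end.

Definition adjG : rel vertex := fun x y => arc x y || arc y x.

Lemma adjG_sym : symmetric adjG.
Proof. by move=> x y; rewrite /adjG orbC. Qed.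

Lemma adjG_irrefl : irreflexive adjG.
Proof. by case=> [i|i|i b|i b|i|i|l|l]; rewrite /adjG /= ?eqxx //; case: l. Qed.

(* Main.v *)
Require Import Defs.
From mathcomp Require Import all_boot zify.

Set Implicit Arguments.
Unset Strict Implicit.
Unset Printing Implicit Defensive.

(** Why 19.  In a connected vertex cover [S], each of the six triangles formed
    by a support vertex and its two private vertices costs at least two
    vertices.  If the support vertex were missing, both private vertices would
    be in [S] and form a connected component on their own; so [S] contains all
    the support vertices ([pendant_triangle]), and the triangles account for at
    least 12 vertices.

    The other vertices form two copies of one bipartite graph, [Q] against [Z]
    and [R] against [U].  Covering either copy takes at least three vertices,
    and three suffice only in one way, namely with all of [Q] (or [R]) and
    nothing of [Z] (or [U]) ([bipartite_cover]).  Fewer than seven vertices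
    would hence mean the cheap choice on both sides, without any vertex of [Z]
    or [U]; but those are the only vertices that link different indices, so
    [S] would be disconnected ([linking_vertex]).

    The bound [12 + 4 + 3] is reached by covering one copy with [Z], which
    connects the [A i] to each other, and the other one with [R], which
    connects each [C i] to [A i]. *)

Lemma induced_closed_eq (T : finType) (e : rel T) (S : {set T}) (a : {pred T})
    (x y : T) :
  induces_connected e S -> closed (induced e S) a -> x \in S -> y \in S ->
  (x \in a) = (y \in a).
Proof. by move=> conS cl_a xS yS; apply: closed_connect (conS _ _ xS yS). Qed.

(** If [s] were missing, [p] and [p'] would both be in [S] and have no neighbour
    in [S] but each other, so that they would be cut off from the endpoint in
    [S] of the edge [u v]; and [s] together with the one of [p], [p'] that
    covers the edge between them makes two. *)
Lemma pendant_triangle (T : finType) (e : rel T) (S : {set T})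
    (s p p' u v : T) :
  symmetric e -> connected_vertex_cover e S ->
  e s p -> e s p' -> e p p' ->
  {in pred2 p p', forall w x, e w x -> x \in pred3 s p p'} ->
  e u v -> u \notin pred2 p p' -> v \notin pred2 p p' ->
  s \in S /\ 1 < (s \in S) + ((p \in S) + (p' \in S)).
Proof.
move=> e_sym [covS conS] /covS sp /covS sp' /covS pp' nbr /covS uv up vp.
suff sS: s \in S.
  by split=> //; move: pp'; rewrite sS; case: (p \in S); case: (p' \in S).
apply/negPn/negP => sS.
have pS : p \in S by move: sp; rewrite (negPf sS).
have stay x y : x \in pred2 p p' -> y \in S -> e x y -> y \in pred2 p p'.
  move=> xp yS /(nbr _ xp); rewrite !inE => /or3P[/eqP ys||->]; last 2 first.
  - by move->.
  - by rewrite orbT.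
  by rewrite -ys yS in sS.
have cl : closed (induced e S) (pred2 p p').
  move=> x y /and3P[xS yS exy]; apply/idP/idP => [xp|yp].
    exact: stay exy.
  by apply: stay yp xS _; rewrite e_sym.
have pE w : w \in S -> w \in pred2 p p'.
  by move=> wS; rewrite -(induced_closed_eq conS cl pS wS) inE eqxx.
by case/orP: uv => /pE; apply/negP.
Qed.

(** The bipartite graph which [adjG] induces both on [Z] and [Q] and on [U]
    and [R]. *)
Definition incident (l : lab) (i : idx) : bool :=
  if l is l0 then i \in [:: i1; i2] else in_pair l i.

(** The edges [l0 i1], [l12 i2], [l23 i3] form a matching, whence the bound 3.
    A cover that misses some [i] contains every [l] incident to [i], and a
    matching among the other edges raises the cost to 4: [l23 i3] for [i1],
    [l13 i3] for [i2], and [l0 i1], [l12 i2] for [i3].  So a cover of size 3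
    consists of all the [i]. *)
Lemma bipartite_cover (g : pred lab) (f : pred idx) :
  (forall l i, incident l i -> g l || f i) ->
  3 < count f idx_enum + count g lab_enum \/
  3 = count f idx_enum + count g lab_enum /\ (forall l, ~~ g l).
Proof.
move=> cov.
have [c1 c2 c3 c4] := And4 (cov l0 i1 isT) (cov l0 i2 isT)
  (cov l12 i1 isT) (cov l12 i2 isT).
have [c5 c6 c7 c8] := And4 (cov l23 i2 isT) (cov l23 i3 isT)
  (cov l13 i1 isT) (cov l13 i3 isT).
suff: 3 < count f idx_enum + count g lab_enum \/
  3 = count f idx_enum + count g lab_enum
  /\ [&& ~~ g l0, ~~ g l12, ~~ g l23 & ~~ g l13].
  case=> [|[? /and4P[? ? ? ?]]]; first by left.
  by right; split=> //; case.
rewrite /= !addn0 {cov}.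
move: (f i1) (f i2) (f i3) (g l0) (g l12) (g l23) (g l13)
  c1 c2 c3 c4 c5 c6 c7 c8.
by do 7!case=> //=; do ?[by left|by right].
Qed.

Lemma card_vertex_set (S : {set vertex}) :
  #|S| = \sum_(i <- idx_enum)
      ((A i \in S) + ((PA i true \in S) + (PA i false \in S)))
    + \sum_(i <- idx_enum)
      ((C i \in S) + ((PC i true \in S) + (PC i false \in S)))
    + (count [pred i | Q i \in S] idx_enum
       + count [pred l | Z l \in S] lab_enum)
    + (count [pred i | R i \in S] idx_enum
       + count [pred l | U l \in S] lab_enum).
Proof.
have -> : #|S| = count (mem S) vertex_enum.
  by rewrite cardE /enum_mem size_filter [Finite.enum]unlock.
(* The memberships are made opaque, so that [lia] treats them as plain
   numbers. *)
rewrite /= !big_cons !big_nil; do ![move: (nat_of_bool _) => ?].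
by lia.
Qed.

Lemma support_A (S : {set vertex}) (i : idx) :
  connected_vertex_cover adjG S ->
  A i \in S /\ 1 < (A i \in S) + ((PA i true \in S) + (PA i false \in S)).
Proof.
move=> cvc; apply: (pendant_triangle adjG_sym cvc (u := C i) (v := Q i)) => //.
1-3,5: by rewrite /adjG /= ?eqxx.
by move=> w /pred2P[]->; case: i => - [[]|[]|[][]|[][]|[]|[]|[]|[]].
Qed.

Lemma support_C (S : {set vertex}) (i : idx) :
  connected_vertex_cover adjG S ->
  C i \in S /\ 1 < (C i \in S) + ((PC i true \in S) + (PC i false \in S)).
Proof.
move=> cvc; apply: (pendant_triangle adjG_sym cvc (u := A i) (v := Q i)) => //.
1-3,5: by rewrite /adjG /= ?eqxx.
by move=> w /pred2P[]->; case: i => - [[]|[]|[][]|[][]|[]|[]|[]|[]].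
Qed.

(** The value [i1] on [Z] and [U] is a dummy: these vertices carry no index. *)
Definition index_of (v : vertex) : idx :=
  match v with
  | A i | C i | PA i _ | PC i _ | Q i | R i => i
  | Z _ | U _ => i1
  end.

(** Every edge that avoids [Z] and [U] joins two vertices of the same index, so
    without these vertices the connected set [S] would lie over one index. *)
Lemma linking_vertex (S : {set vertex}) :
  induces_connected adjG S -> A i1 \in S -> A i2 \in S ->
  ~ ((forall l, Z l \notin S) /\ (forall l, U l \notin S)).
Proof.
move=> conS A1 A2 [noZ noU].
have has_index v : v \in S -> if v is (Z _ | U _) then false else true.
  by case: v => // l; rewrite ?(negPf (noZ l)) ?(negPf (noU l)).
have cl : closed (induced adjG S) [pred v | index_of v == i1].
  move=> x y /and3P[/has_index xS /has_index yS]; rewrite /adjG !inE.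
  case: x xS => [i|i|i b|i b|i|i|l|l] // _;
  case: y yS => [j|j|j b'|j b'|j|j|l|l] // _ /=; rewrite ?orbF //;
  by [move/eqP-> | case/orP=> /andP[/eqP->]].
by have := induced_closed_eq conS cl A1 A2.
Qed.

(** One private vertex per support vertex, and the covers [Z] and [R] of the
    two bipartite graphs. *)
Definition cover19 : {set vertex} :=
  [set v | match v with
           | A _ | C _ | Z _ | R _ => true
           | PA _ b | PC _ b => b
           | Q _ | U _ => false
           end].

Lemma card_cover19 : #|cover19| = 19.
Proof. by rewrite card_vertex_set /= !big_cons !big_nil !inE. Qed.

Lemma cover19_vertex_cover : vertex_cover adjG cover19.
Proof.
move=> x y; rewrite !inE /adjG.
case: x => [i|i|i []|i []|i|i|l|l]; case: y => [j|j|j []|j []|j|j|k|k] //=;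
by [rewrite !andbF | case: l | case: k | case: l; case: k].
Qed.

(** Everything is connected to [A i1], which is adjacent to every vertex of [Z]
    but [Z l23], and reaches [A i2] and [A i3] through [Z l12] and
    [Z l13]. *)
Lemma cover19_connected : induces_connected adjG cover19.
Proof.
move=> x y xS yS.
have csym : connect_sym (induced adjG cover19).
  by apply: sym_connect_sym => u v; rewrite /induced /= andbCA adjG_sym.
suff reach v : v \in cover19 -> connect (induced adjG cover19) (A i1) v.
  by apply: connect_trans (reach y yS); rewrite csym reach.
have step u w : u \in cover19 -> w \in cover19 -> adjG u w ->
    connect (induced adjG cover19) (A i1) u ->
    connect (induced adjG cover19) (A i1) w.
  by move=> uS wS uw /connect_trans; apply; apply: connect1; apply/and3P.
have Z12 : connect (induced adjG cover19) (A i1) (Z l12).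
  by apply: (step (A i1)); rewrite ?inE.
have Z13 : connect (induced adjG cover19) (A i1) (Z l13).
  by apply: (step (A i1)); rewrite ?inE.
have reachA i : connect (induced adjG cover19) (A i1) (A i).
  case: i => //; first by apply: step Z12; rewrite ?inE.
  by apply: step Z13; rewrite ?inE.
have reachR i : connect (induced adjG cover19) (A i1) (R i).
  by apply: step (reachA i); rewrite ?inE // /adjG /= eqxx.
have reachC i : connect (induced adjG cover19) (A i1) (C i).
  by apply: step (reachR i); rewrite ?inE // /adjG /= eqxx.
case: v => [i|i|i b|i b|i|i|l|l]; rewrite inE // => vS.
- by apply: step (reachA i); rewrite ?inE // /adjG /= ?eqxx.
- by apply: step (reachC i); rewrite ?inE // /adjG /= ?eqxx.
- case: l vS => // vS; first by apply: step (reachA i1); rewrite ?inE.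
  by apply: step (reachA i2); rewrite ?inE.
Qed.

Theorem lemma5 :
  (exists2 S : {set vertex}, connected_vertex_cover adjG S & #|S| = 19) /\
  (forall S : {set vertex}, connected_vertex_cover adjG S -> 19 <= #|S|).
Proof.
split.
  exists cover19; last exact: card_cover19.
  by split; [exact: cover19_vertex_cover|exact: cover19_connected].
move=> S cvc; have [covS conS] := cvc.
have sumA : 6 <= \sum_(i <- idx_enum)
    ((A i \in S) + ((PA i true \in S) + (PA i false \in S))).
  rewrite !big_cons big_nil -[6]/(2 + (2 + (2 + 0))).
  by rewrite !leq_add //; apply: proj2 (support_A _ cvc).
have sumC : 6 <= \sum_(i <- idx_enum)
    ((C i \in S) + ((PC i true \in S) + (PC i false \in S))).
  rewrite !big_cons big_nil -[6]/(2 + (2 + (2 + 0))).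
  by rewrite !leq_add //; apply: proj2 (support_C _ cvc).
have [A1 _] := support_A i1 cvc; have [A2 _] := support_A i2 cvc.
have noZU := linking_vertex conS A1 A2.
have coverQZ l i : incident l i -> (Z l \in S) || (Q i \in S).
  by move=> li; apply: covS; rewrite /adjG; case: l li => /= ->.
have coverRU l i : incident l i -> (U l \in S) || (R i \in S).
  by move=> li; apply: covS; rewrite /adjG; case: l li => /= ->.
have := bipartite_cover (g := [pred l | Z l \in S])
  (f := [pred i | Q i \in S]) coverQZ.
have := bipartite_cover (g := [pred l | U l \in S])
  (f := [pred i | R i \in S]) coverRU.
rewrite card_vertex_set; move: sumA sumC.
do 2!move: (\sum_(_ <- _) _) => ?; do 2!move: (count _ _ + count _ _) => ?.
move=> ? ? [?|[? noU]] [?|[? noZ]]; [lia|lia|lia|].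
by case: noZU.
Qed.
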